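(* Let $\alpha_0,\dots,\alpha_4$ be complex parameters with $\alpha_0+\alpha_1+2\alpha_2+\alpha_3+\alpha_4=1$, and consider the system $$\frac{dx}{dt}=\frac{2x^2y-x^2+(\alpha_0+\alpha_1)x-2w}{t}+1,\qquad \frac{dy}{dt}=\frac{-2xy^2+2xy-(\alpha_0+\alpha_1)y+\alpha_1}{t},$$ $$\frac{dz}{dt}=\frac{2z^2w-tz^2-(1-\alpha_3-\alpha_4)z+1-2y}{t},\qquad \frac{dw}{dt}=\frac{-2zw^2+2tzw+(1-\alpha_3-\alpha_4)w+\alpha_3t}{t}.$$ This system admits affine Weyl group symmetry of type $D_4^{(1)}$ as the group of its Bäcklund transformations, with generators given explicitly as follows. Writing $( * )=(x,y,z,w,t;\alpha_0,\alpha_1,\alpha_2,\alpha_3,\alpha_4)$, set $$s_0:( * )\mapsto\left(x+\tfrac{\alpha_0}{y-1},y,z,w,t;-\alpha_0,\alpha_1,\alpha_2+\alpha_0,\alpha_3,\alpha_4\right),$$ $$s_1:( * )\mapsto\left(x+\tfrac{\alpha_1}{y},y,z,w,t;\alpha_0,-\alpha_1,\alpha_2+\alpha_1,\alpha_3,\alpha_4\right),$$ $$s_2:( * )\mapsto\left(x,y-\tfrac{\alpha_2z}{xz-1},z,w-\tfrac{\alpha_2x}{xz-1},t;\alpha_0+\alpha_2,\alpha_1+\alpha_2,-\alpha_2,\alpha_3+\alpha_2,\alpha_4+\alpha_2\right),$$ $$s_3:( * )\mapsto\left(x,y,z+\tfrac{\alpha_3}{w},w,t;\alpha_0,\alpha_1,\alpha_2+\alpha_3,-\alpha_3,\alpha_4\right),$$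 $$s_4:( * )\mapsto\left(x,y,z+\tfrac{\alpha_4}{w-t},w,t;\alpha_0,\alpha_1,\alpha_2+\alpha_4,\alpha_3,-\alpha_4\right),$$ $$\pi_1:( * )\mapsto(-x,1-y,-z,-w,-t;\alpha_1,\alpha_0,\alpha_2,\alpha_3,\alpha_4),$$ $$\pi_2:( * )\mapsto(x,y,z,w-t,-t;\alpha_0,\alpha_1,\alpha_2,\alpha_4,\alpha_3),$$ $$\pi_3:( * )\mapsto\left(tz,\tfrac{w}{t},\tfrac{x}{t},ty,t;\alpha_4,\alpha_3,\alpha_2,\alpha_1,\alpha_0\right),$$ $$\pi_4:( * )\mapsto\left(-tz,\tfrac{t-w}{t},-\tfrac{x}{t},t-ty,t;\alpha_3,\alpha_4,\alpha_2,\alpha_0,\alpha_1\right).$$ That is: (a) each of $s_0,\dots,s_4,\pi_1,\dots,\pi_4$ is a Bäcklund transformation of the system; (b) $s_0,\dots,s_4$ satisfy the defining relations of the affine Weyl group of type $D_4^{(1)}$.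
   Context: The system is the Hamiltonian system $dx/dt=\partial H/\partial y$, $dy/dt=-\partial H/\partial x$, $dz/dt=\partial H/\partial w$, $dw/dt=-\partial H/\partial z$ with $$tH=x^2y(y-1)+x\{(\alpha_0+\alpha_1)y-\alpha_1\}+ty+z^2w(w-t)-z\{(1-\alpha_3-\alpha_4)w+\alpha_3t\}+w-2yw.$$ Each transformation is regarded as an automorphism of the field of rational functions in $x,y,z,w,t$ and the parameters (subject to the linear relation on the parameters), given by the images of the generators. A transformation $\sigma$ is a Bäcklund transformation if, whenever $(x(t),y(t),z(t),w(t))$ is a solution of the system with parameters $\alpha_i$ (for which the expressions are defined), the functions $\sigma(x),\sigma(y),\sigma(z),\sigma(w)$, viewed as functions of the new independent variable $\sigma(t)$, solve the same system with parameters $\sigma(\alpha_i)$. The Dynkin diagram of type $D_4^{(1)}$ has nodes $0,1,2,3,4$, with node $2$ joined by a simple edge to each of $0,1,3,4$ and no other edges. The defining relations of the affine Weyl group are $s_i^2=1$, $(s_is_j)^2=1$ for distinct non-adjacent $i,j$, and $(s_is_j)^3=1$ for adjacent $i,j$. *)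

(* Defs.v *)
From HB Require Import structures.
From mathcomp Require Import all_boot all_order all_algebra.
From mathcomp Require Import all_classical all_reals all_analysis.
From mathcomp Require Import complex ring.
(* Only the canonical structures are imported: the notations of mpoly clash
   with those of mathcomp-analysis. *)
From mathcomp Require mpoly.
Import (canonicals) mpoly.

Set Implicit Arguments.
Unset Strict Implicit.
Unset Printing Implicit Defensive.

Import Order.TTheory GRing.Theory Num.Theory.
Import numFieldNormedType.Exports.

Local Open Scope classical_set_scope.
Local Open Scope ring_scope.

(* The ascription gives R[i] the topology of its modulus, so that below
   [open] and [is_derive] are openness in C and complex differentiability. *)
Definition complex_field (R : realType) : numClosedFieldType := R[i].

Definition param_rel (K : nzRingType) (a : 'I_5 -> K) : Prop :=
  a 0 + a 1 + 2 * a 2 + a 3 + a 4 = 1.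

(* C(x, y, z, w, t, alpha_0, ..., alpha_4) subject to the linear relation on
   the alpha_i, presented by eliminating alpha_0: the nine indeterminates are,
   in this order, x, y, z, w, t, alpha_1, alpha_2, alpha_3, alpha_4. *)
Definition ratfun (C : numFieldType) : fieldType :=
  {fraction (mpoly.mpoly 9 C)}.

Definition ratpoly (C : numFieldType) (p : mpoly.mpoly 9 C) : ratfun C :=
  FracField.tofrac p.

Definition ratconst (C : numFieldType) (c : C) : ratfun C :=
  ratpoly (mpoly.mpolyC 9 c).

Definition indet (C : numFieldType) (i : 'I_9) : ratfun C :=
  ratpoly (mpoly.mpolyX C (mpoly.mnm1 i)).

Definition rx (C : numFieldType) : ratfun C := indet C 0.
Definition ry (C : numFieldType) : ratfun C := indet C 1.
Definition rz (C : numFieldType) : ratfun C := indet C 2.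
Definition rw (C : numFieldType) : ratfun C := indet C 3.
Definition rt (C : numFieldType) : ratfun C := indet C 4.

Definition ralpha (C : numFieldType) (i : 'I_5) : ratfun C :=
  [:: 1 - indet C 5 - 2 * indet C 6 - indet C 7 - indet C 8;
      indet C 5; indet C 6; indet C 7; indet C 8]`_i.

Lemma ralpha_rel (C : numFieldType) : param_rel (ralpha C).
Proof. rewrite /param_rel /ralpha /=; ring. Qed.

(* Values of x, y, z, w, t and of the parameters, listed in the order of the
   indeterminates; a 0 is omitted since it is determined by [param_rel]. *)
Definition point (C : numFieldType) (x y z w t : C) (a : 'I_5 -> C) :
    'I_9 -> C :=
  fun i => [:: x; y; z; w; t; a 1; a 2; a 3; a 4]`_i.

(* F is defined (regular) at v, with value c. *)
Definition has_value (C : numFieldType) (F : ratfun C) (v : 'I_9 -> C) (c : C)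
    : Prop :=
  exists p q : mpoly.mpoly 9 C,
    [/\ F = ratpoly p / ratpoly q, mpoly.meval v q != 0
      & c = mpoly.meval v p / mpoly.meval v q].

Record automorphism (C : numFieldType) := Automorphism {
  aut_morph :> {rmorphism ratfun C -> ratfun C};
  aut_bij : bijective aut_morph;
  aut_const : forall c : C, aut_morph (ratconst c) = ratconst c
}.

(* An automorphism is determined by its values on this list. *)
Definition generators (C : numFieldType) : seq (ratfun C) :=
  [:: rx C; ry C; rz C; rw C; rt C;
      ralpha C 0; ralpha C 1; ralpha C 2; ralpha C 3; ralpha C 4].

(* (x, y, z, w) is a solution, on the open set D not containing 0, of the
   system with parameters a; t is the complex independent variable. *)
Record is_solution (C : numFieldType) (a : 'I_5 -> C) (D : set C)
    (x y z w : C -> C) : Prop := IsSolution {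
  sol_param : param_rel a;
  sol_open : open D;
  sol_neq0 : ~ D 0;
  sol_x : forall t, D t -> is_derive t 1 x
    ((2 * x t ^+ 2 * y t - x t ^+ 2 + (a 0 + a 1) * x t - 2 * w t) / t + 1);
  sol_y : forall t, D t -> is_derive t 1 y
    ((- 2 * x t * y t ^+ 2 + 2 * x t * y t - (a 0 + a 1) * y t + a 1) / t);
  sol_z : forall t, D t -> is_derive t 1 z
    ((2 * z t ^+ 2 * w t - t * z t ^+ 2 - (1 - a 3 - a 4) * z t + 1 - 2 * y t)
     / t);
  sol_w : forall t, D t -> is_derive t 1 w
    ((- 2 * z t * w t ^+ 2 + 2 * t * z t * w t + (1 - a 3 - a 4) * w t
      + a 3 * t) / t)
}.

(* X, Y, Z, W, T and A are the values of the transformed generators along the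
   solution; T is the new independent variable, and x', y', z', w' are
   X, Y, Z, W viewed as functions of it. *)
Definition Backlund (C : numFieldType) (sigma : automorphism C) : Prop :=
  forall (a : 'I_5 -> C) (D : set C) (x y z w : C -> C),
  is_solution a D x y z w ->
  forall (X Y Z W T : C -> C) (A : 'I_5 -> C -> C),
  (forall t, D t ->
     let v := point (x t) (y t) (z t) (w t) t a in
     [/\ has_value (sigma (rx C)) v (X t), has_value (sigma (ry C)) v (Y t),
         has_value (sigma (rz C)) v (Z t), has_value (sigma (rw C)) v (W t)
       & has_value (sigma (rt C)) v (T t)] /\
     (forall i, has_value (sigma (ralpha C i)) v (A i t))) ->
  exists (b : 'I_5 -> C) (x' y' z' w' : C -> C),
    [/\ forall i t, D t -> A i t = b i,
        forall t, D t ->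
          [/\ x' (T t) = X t, y' (T t) = Y t, z' (T t) = Z t
            & w' (T t) = W t]
      & is_solution b (T @` D) x' y' z' w'].

Definition D4_adjacent (i j : 'I_5) : bool :=
  (i != j) && ((i == 2) || (j == 2)).

(* The order required of s_i s_j. *)
Definition D4_exponent (i j : 'I_5) : nat :=
  if i == j then 1%N else if D4_adjacent i j then 3 else 2.

(* Main.v *)
(* Transformations of the rational function field are handled through one
   relation, [evals psi F c]: F = p / q with psi q != 0 and c = psi p / psi q,
   where psi is a ring morphism on polynomials.  For psi the evaluation at a
   point it is [has_value]; for psi the substitution of nine rational functions
   g_i for the indeterminates it is the partially defined endomorphism of the
   field induced by g.  If the latter sends every g_i back to the i-th
   indeterminate, then every polynomial p is recovered from its image, so the
   substitution is injective and extends to an involutive automorphism; all nine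
   transformations are of this kind.  Since the s_i are involutions, the Coxeter
   relations reduce to commutation or braid identities on generators.

   For the Backlund property, sigma x = x + alpha / d has no value where d = 0:
   a value at a point would persist at nearby points of a line in the parameter
   space along which d stays 0 and alpha varies, but there the numerator is not
   zero.  So d does not vanish along the solution, and what remains is a
   differentiation followed by a rational identity. *)

From HB Require Import structures.
Require Import Defs.
From mathcomp Require Import all_boot all_order all_algebra.
From mathcomp Require Import all_classical all_reals all_analysis.
From mathcomp Require Import generic_quotient fraction ring.
From mathcomp Require mpoly.
Import (canonicals) mpoly.
Import Order.TTheory GRing.Theory Num.Theory.
Import numFieldNormedType.Exports.
Set Implicit Arguments.
Unset Strict Implicit.
Unset Printing Implicit Defensive.
Local Open Scope ring_scope.

(** * Values of rational functions along a ring morphism on polynomials *)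

Section Evaluation.
Variable C : numFieldType.
Implicit Types (F G : ratfun C) (p q : mpoly.mpoly 9 C).

HB.instance Definition _ :=
  GRing.RMorphism.copy (@ratpoly C) (@FracField.tofrac (mpoly.mpoly 9 C)).
HB.instance Definition _ :=
  GRing.RMorphism.copy (@ratconst C) (@ratpoly C \o @mpoly.mpolyC 9 C).

Lemma ratpoly_eq0 p : (ratpoly p == 0) = (p == 0).
Proof. exact: tofrac_eq0. Qed.

Lemma ratfunP F : exists p q, q != 0 /\ F = ratpoly p / ratpoly q.
Proof.
elim/quotW: F => u; exists (frac u).1, (frac u).2.
have d0 := denom_ratioP u; split=> //.
(* After multiplication by the denominator the goal is an equation between a product of two classes
   and a class, which becomes an equivalence of explicit ratios. *)
apply: (mulIf (_ : ratpoly (frac u).2 != 0)); first by rewrite ratpoly_eq0.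
rewrite divfK ?ratpoly_eq0 // /ratpoly; unlock FracField.tofrac.
rewrite -[LHS]/(FracField.mul _ _).
rewrite -(FracField.pi_mul u (Ratio (frac u).2 1)).
apply/eqmodP; rewrite /= FracField.equivfE /FracField.mulf.
rewrite !numden_Ratio ?oner_eq0 ?mulr1 //.
by rewrite mulrC.
Qed.

(** Induction on ring generators: whatever is compatible with sums and products, such as agreement
    of two morphisms, need only be checked on constants and indeterminates. *)
Lemma mpoly_gen_ind (P : mpoly.mpoly 9 C -> Prop) :
  (forall c, P (mpoly.mpolyC 9 c)) ->
  (forall i, P (mpoly.mpolyX C (mpoly.mnm1 i))) ->
  (forall p q, P p -> P q -> P (p + q)) ->
  (forall p q, P p -> P q -> P (p * q)) -> forall p, P p.
Proof.
move=> PC PX PD PM; elim/mpoly.mpolyind => [|c m p _ _ Pp].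
  by rewrite -mpoly.mpolyC0.
apply: (PD) => //; rewrite -mpoly.mul_mpolyC; apply: (PM) => //.
rewrite mpoly.mpolyXE_id; apply: big_ind => [||i _]; [by rewrite -mpoly.mpolyC1|exact: (PM)|].
by elim: (mpoly.fun_of_multinom m i) => [|k IH]; rewrite ?expr0 -?mpoly.mpolyC1 // exprS; apply: (PM).
Qed.

Definition evals (L : fieldType) (psi : mpoly.mpoly 9 C -> L) F (c : L) : Prop :=
  exists p q, [/\ F = ratpoly p / ratpoly q, psi q != 0 & c = psi p / psi q].

Section Evals.
Variables (L : fieldType) (psi : {rmorphism mpoly.mpoly 9 C -> L}).
Local Notation evals := (evals psi).

Lemma evals_poly p : evals (ratpoly p) (psi p).
Proof. by exists p, 1; rewrite !rmorph1 oner_neq0 !divr1. Qed.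

Lemma psi_neq0 q : psi q != 0 -> ratpoly q != 0.
Proof. by rewrite ratpoly_eq0; apply: contraNneq => ->; rewrite rmorph0. Qed.

(** Two fractions for [F] have equal cross products already as polynomials, because polynomials
    embed in their fraction field; applying [psi] to that identity equates the two values. *)
Lemma evals_inj F c d : evals F c -> evals F d -> c = d.
Proof.
move=> [p [q [-> q0 ->]]] [p' [q' [e q'0 ->]]].
move/eqP: e; rewrite eqr_div ?psi_neq0 // -!rmorphM -subr_eq0 -rmorphB ratpoly_eq0 subr_eq0.
by move=> /eqP /(congr1 psi); rewrite !rmorphM => e; apply/eqP; rewrite eqr_div // e.
Qed.

Lemma evalsD F G c d : evals F c -> evals G d -> evals (F + G) (c + d).
Proof.
move=> [p [q [-> q0 ->]]] [p' [q' [-> q'0 ->]]].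
exists (p * q' + p' * q), (q * q').
rewrite !rmorphD !rmorphM mulf_neq0 // !addf_div //; exact: (psi_neq0).
Qed.

Lemma evalsM F G c d : evals F c -> evals G d -> evals (F * G) (c * d).
Proof.
move=> [p [q [-> q0 ->]]] [p' [q' [-> q'0 ->]]].
by exists (p * p'), (q * q'); rewrite !rmorphM mulf_neq0 // !mulf_div.
Qed.

Lemma evalsN F c : evals F c -> evals (- F) (- c).
Proof. by move=> [p [q [-> q0 ->]]]; exists (- p), q; rewrite !rmorphN !mulNr. Qed.

Lemma evalsV F c : evals F c -> c != 0 -> evals F^-1 c^-1.
Proof.
move=> [p [q [-> q0 ->]]]; rewrite mulf_eq0 negb_or => /andP[p0 _].
by exists q, p; rewrite !invf_div.
Qed.

Lemma evals1 : evals 1 1.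
Proof. by have := evals_poly 1; rewrite !rmorph1. Qed.

Lemma evals0 : evals 0 0.
Proof. by have := evals_poly 0; rewrite !rmorph0. Qed.

Lemma evals_nat n : evals n%:R n%:R.
Proof. by have := evals_poly n%:R; rewrite !rmorph_nat. Qed.

(** A rational function is shown to be nonzero by exhibiting a single nonzero value. *)
Lemma evals_neq0 F c : evals F c -> c != 0 -> F != 0.
Proof.
by move=> Fc; apply: contra_neq => F0; move: Fc; rewrite F0 => /evals_inj /(_ evals0).
Qed.

End Evals.

Lemma evals_eq (L : fieldType) (psi : mpoly.mpoly 9 C -> L) F c d :
  evals psi F d -> d = c -> evals psi F c.
Proof. by move=> Fd <-. Qed.

Lemma has_valueE F v c : has_value F v c = evals (mpoly.meval v) F c.
Proof. by []. Qed.

End Evaluation.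

(** * Involutive automorphisms from substitutions *)

Section Involution.
Variable C : numFieldType.
Variable g : 'I_9 -> ratfun C.

Definition subst : mpoly.mpoly 9 C -> ratfun C := mpoly.mmap (@ratconst C) g.

HB.instance Definition _ := GRing.RMorphism.on subst.

Lemma substC c : subst (mpoly.mpolyC 9 c) = ratconst c.
Proof. exact: mpoly.mmapC. Qed.

Lemma substX i : subst (mpoly.mpolyX C (mpoly.mnm1 i)) = g i.
Proof. by rewrite /subst mpoly.mmapX mpoly.mmap1U. Qed.

Lemma evals_indet i : evals subst (indet C i) (g i).
Proof. by rewrite -substX; exact: evals_poly. Qed.

Lemma evals_ratconst c : evals subst (ratconst c) (ratconst c).
Proof. by rewrite -{2}substC; exact: evals_poly. Qed.

(* The endomorphism induced by g is an involution. *)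
Hypothesis gK : forall i, evals subst (g i) (indet C i).

(** The second application is stated through [evals] because [subst p] is a fraction, on which the
    substitution is so far only partially defined. *)
Lemma evals_substK p : evals subst (subst p) (ratpoly p).
Proof.
elim/mpoly_gen_ind: p => [c|i|p q IHp IHq|p q IHp IHq].
- by rewrite substC; exact: evals_ratconst.
- by rewrite substX; exact: gK.
- by rewrite !rmorphD; exact: evalsD.
- by rewrite !rmorphM; exact: evalsM.
Qed.

Lemma subst_eq0 p : (subst p == 0) = (p == 0).
Proof.
apply/eqP/eqP => [p0|->]; last exact: rmorph0.
apply/eqP; rewrite -ratpoly_eq0; apply/eqP.
by have := evals_substK p; rewrite p0 => /evals_inj; apply; exact: evals0.
Qed.

Lemma evals_total F : exists G, evals subst F G.
Proof.
have [p [q [q0 ->]]] := ratfunP F.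
by exists (subst p / subst q), p, q; rewrite subst_eq0.
Qed.

(** The value is picked by choice; since [evals_inj] makes it unique, [ratsubstP] characterizes it
    completely. *)
Definition ratsubst F : ratfun C := sval (cid (evals_total F)).

Lemma ratsubstP F : evals subst F (ratsubst F).
Proof. by rewrite /ratsubst; case: cid. Qed.

Lemma ratsubst_zmod : zmod_morphism ratsubst.
Proof.
move=> F G; apply: evals_inj (ratsubstP _) _.
by apply: evalsD; [|apply: evalsN]; exact: ratsubstP.
Qed.

Lemma ratsubst_monoid : monoid_morphism ratsubst.
Proof.
split=> [|F G]; apply: evals_inj (ratsubstP _) _; first exact: evals1.
by apply: evalsM; exact: ratsubstP.
Qed.

HB.instance Definition _ := GRing.isZmodMorphism.Build _ _ ratsubst ratsubst_zmod.
HB.instance Definition _ := GRing.isMonoidMorphism.Build _ _ ratsubst ratsubst_monoid.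

Lemma ratsubst_poly p : ratsubst (ratpoly p) = subst p.
Proof. by apply: evals_inj (ratsubstP _) _; exact: evals_poly. Qed.

Lemma ratsubstK : involutive ratsubst.
Proof.
move=> F; have [p [q [q0 ->]]] := ratfunP F.
rewrite !fmorph_div /= !ratsubst_poly; congr (_ / _);
by apply: evals_inj (ratsubstP _) _; exact: evals_substK.
Qed.

Lemma ratsubst_const c : ratsubst (ratconst c) = ratconst c.
Proof. by rewrite -{2}substC; exact: ratsubst_poly. Qed.

Lemma involutive_automorphism :
  exists s : automorphism C, involutive s /\ forall i, s (indet C i) = g i.
Proof.
exists (Automorphism (inv_bij ratsubstK) ratsubst_const).
split=> [|i]; first exact: ratsubstK.
by rewrite -substX; exact: ratsubst_poly.
Qed.

End Involution.

Lemma automorphism_eq (C : numFieldType) (f h : {rmorphism ratfun C -> ratfun C}) :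
  (forall c, f (ratconst c) = h (ratconst c)) ->
  (forall i, f (indet C i) = h (indet C i)) -> f =1 h.
Proof.
move=> fhC fhX F; have [p [q [_ ->]]] := ratfunP F.
suff fh r : f (ratpoly r) = h (ratpoly r) by rewrite !fmorph_div !fh.
elim/mpoly_gen_ind: r => // r u IHr IHu; first by rewrite !rmorphD IHr IHu.
by rewrite !rmorphM IHr IHu.
Qed.

Ltac nonzero :=
  repeat (apply/andP; split);
  match goal with H : is_true (?e != 0) |- is_true (?e != 0) => exact H end.

(** The value may be an existential variable: it is built by descending through the expression, with
    known values at the leaves and [side] proving that inverted values are nonzero. *)
Ltac evals_compute side :=
  lazymatch goal with
  | |- has_value ?F ?v ?c => change (evals (mpoly.meval v) F c); evals_compute side
  | |- evals _ (_ + _) _ => eapply evalsD; evals_compute side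
  | |- evals _ (_ * _) _ => eapply evalsM; evals_compute side
  | |- evals _ (- _) _ => eapply evalsN; evals_compute side
  | |- evals _ (_ ^-1) _ => eapply evalsV; [evals_compute side | side]
  | |- evals _ 0 _ => eapply evals0
  | |- evals _ 1 _ => eapply evals1
  | |- evals _ (_ %:R) _ => eapply evals_nat
  | H : evals _ ?F _ |- evals _ ?F _ => exact H
  | |- _ => eassumption
  end.

(** * Values of the generators at a point *)

Section Points.
Variable C : numFieldType.
Implicit Types (x y z w t : C) (a : 'I_5 -> C).

Lemma param_rel_a0 (K : comNzRingType) (a : 'I_5 -> K) :
  param_rel a -> a 0 = 1 - a 1 - 2 * a 2 - a 3 - a 4.
Proof.
move=> aP; have -> : a 0 = (a 0 + a 1 + 2 * a 2 + a 3 + a 4)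
  - a 1 - 2 * a 2 - a 3 - a 4 by ring.
by rewrite aP.
Qed.

Lemma ord5P (P : 'I_5 -> Prop) :
  P 0 -> P 1 -> P 2 -> P 3 -> P 4 -> forall i, P i.
Proof.
move=> P0 P1 P2 P3 P4 [[|[|[|[|[|i]]]]] Hi] //;
  [move: P0|move: P1|move: P2|move: P3|move: P4]; congr P; exact: val_inj.
Qed.

Lemma evals_point x y z w t a : param_rel a ->
  let ev := evals (mpoly.meval (Defs.point x y z w t a)) in
  [/\ ev (rx C) x, ev (ry C) y, ev (rz C) z, ev (rw C) w & ev (rt C) t] /\
  (forall k, ev (ralpha C k) (a k)).
Proof.
move=> aP ev.
have evX i : ev (indet C i) (Defs.point x y z w t a i).
  by rewrite -(mpoly.mevalXU (Defs.point x y z w t a) i); exact: evals_poly.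
have e1 := evX 5; have e2 := evX 6; have e3 := evX 7; have e4 := evX 8.
split; first by split; exact: evX.
apply: ord5P => //; rewrite (param_rel_a0 aP) /ralpha /= /ev.
by evals_compute idtac.
Qed.

End Points.

(** * Regularity along lines in the parameter space and nonvanishing of denominators *)

Lemma poly_nonroot (C : numFieldType) (p : {poly C}) : p != 0 -> exists s, ~~ root p s.
Proof.
move=> p0; apply: contrapT => H.
(* In characteristic zero the first [size p] naturals are distinct, which is one root more than the
   degree allows. *)
have /(max_poly_roots p0) : all (root p) [seq i%:R | i <- iota 0 (size p)].
  by apply/allP => s _; apply: contrapT => /negP Hs; apply: H; exists s.
rewrite map_inj_uniq ?iota_uniq; last by move=> i j /eqP; rewrite eqr_nat => /eqP.
by rewrite size_map size_iota ltnn => /(_ isT).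
Qed.

(** Restricted to the line, the denominator is a polynomial in [s] that is nonzero because its value
    at [s = 0] is [q] at [v]; hence it has a nonroot. *)
Lemma has_value_line (C : numFieldType) (F : ratfun C) (v e : 'I_9 -> C) c s0 :
  has_value F v c ->
  exists s d, s != s0 /\ has_value F (fun i => v i + s * e i) d.
Proof.
move=> [p [q [-> qv _]]].
pose h i : {poly C} := (v i)%:P + (e i)%:P * 'X.
pose l : mpoly.mpoly 9 C -> {poly C} := mpoly.mmap (@polyC C) h.
have hornerl r s : (l r).[s] = mpoly.meval (fun i => v i + s * e i) r.
  elim/mpoly_gen_ind: r => [k|i|r u IHr IHu|r u IHr IHu].
  - by rewrite /l mpoly.mmapC mpoly.mevalC hornerC.
  - by rewrite /l mpoly.mmapX mpoly.mmap1U mpoly.mevalXU /h !hornerE mulrC.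
  - by rewrite /l !rmorphD /= hornerD IHr IHu.
  - by rewrite /l !rmorphM /= hornerM IHr IHu.
have lq : l q != 0.
  apply: contraNneq qv => lq0; move: (hornerl q 0); rewrite lq0 horner0 => ->.
  by apply/eqP/mpoly.meval_eq => i; rewrite mul0r addr0.
(* The extra linear factor forces the nonroot to differ from [s0]. *)
have [|s] := @poly_nonroot _ (l q * ('X - s0%:P)).
  by rewrite mulf_neq0 // polyXsubC_eq0.
rewrite rootM root_XsubC negb_or => /andP[ls ss0].
eexists s, _; split=> //; exists p, q; split=> //.
by rewrite -hornerl.
Qed.

Lemma has_value_param_line (C : numFieldType) (F : ratfun C) x y z w t
    (a e : 'I_5 -> C) c s0 :
  has_value F (Defs.point x y z w t a) c ->
  exists s d, s != s0 /\
    has_value F (Defs.point x y z w t (fun i => a i + s * e i)) d.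
Proof.
move=> /(has_value_line (Defs.point 0 0 0 0 0 e) s0) [s [d [ss0 Fd]]].
exists s, d; split=> //; congr has_value: Fd; apply/funext => i.
case: i => [] [|[|[|[|[|[|[|[|[|]]]]]]]]] //= i; by rewrite /Defs.point /= ?mulr0 ?addr0.
Qed.

(** The change of the k-th parameter is absorbed by the parameter 0, or by the parameter 1 when k is
    0, so that the line stays in the hyperplane [param_rel]; the entry -2 offsets the coefficient 2
    of [a 2]. *)
Lemma param_direction (C : numFieldType) (k : 'I_5) :
  exists e : 'I_5 -> C, e k = 1 /\
    forall a s, param_rel a -> param_rel (fun i => a i + s * e i).
Proof.
have [e [ek e0]] : exists e : 'I_5 -> C,
    e k = 1 /\ e 0 + e 1 + 2 * e 2 + e 3 + e 4 = 0.
  elim/ord5P: k.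
  - by exists (fun i => [:: 1; -1; 0; 0; 0]`_i); split=> //=; ring.
  - by exists (fun i => [:: -1; 1; 0; 0; 0]`_i); split=> //=; ring.
  - by exists (fun i => [:: -2; 0; 1; 0; 0]`_i); split=> //=; ring.
  - by exists (fun i => [:: -1; 0; 0; 1; 0]`_i); split=> //=; ring.
  - by exists (fun i => [:: -1; 0; 0; 0; 1]`_i); split=> //=; ring.
exists e; split=> // a s aP; rewrite /param_rel.
rewrite (_ : _ + _ = (a 0 + a 1 + 2 * a 2 + a 3 + a 4)
  + s * (e 0 + e 1 + 2 * e 2 + e 3 + e 4)); last by ring.
by rewrite aP e0 mulr0 addr0.
Qed.

(** The values [m], [u], [d] are the same at all admissible parameters, hence constant along the
    line. If [d] were 0, multiplying the function by [D] would give [0 = (a k + s) * u] there.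
    Moving off [a] is essential because [a k] itself may be 0. *)
Lemma regular_denominator_neq0 (C : numFieldType) (k : 'I_5) (M U D : ratfun C) x y z w t a c m u d :
  param_rel a -> has_value (M + ralpha C k * U / D) (Defs.point x y z w t a) c ->
  (forall b, param_rel b ->
    let ev := evals (mpoly.meval (Defs.point x y z w t b)) in
    [/\ ev M m, ev U u & ev D d]) ->
  D != 0 -> u != 0 -> d != 0.
Proof.
move=> aP Fc MUD D0 u0; apply/eqP => d0.
have [e [ek eP]] := param_direction C k.
(* Excluding [s = - a k] keeps the k-th parameter nonzero at the new point. *)
have [s [c' [sa Fs]]] := has_value_param_line e (- a k) Fc.
have bP := eP _ s aP; have [_ /(_ k) evk] := evals_point x y z w t bP.
have [evM evU evD] := MUD _ bP.
have := evalsM Fs evD; rewrite mulrDl divfK // d0 => /evals_inj.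
have := evalsD (evalsM evM evD) (evalsM evk evU).
move=> evN /(_ _ evN); rewrite d0 !mulr0 add0r ek mulr1 => /esym/eqP.
by rewrite mulf_eq0 (negbTE u0) orbF addrC addr_eq0 (negbTE sa).
Qed.

(** * Complex derivatives *)

Section Derivatives.
Variable C : numFieldType.
Implicit Types (f g : C -> C) (t d df dg : C).

(** Since [e * (e * t) = t], the difference quotient in direction 1 is that of [f] at [t] in
    direction [e], and the differential is linear. With [e = -1] this handles time reversal. *)
Lemma is_derive_scale f t e d : e * e = 1 ->
  is_derive t 1 f d -> is_derive (e * t) 1 (fun u => f (e * u)) (e * d).
Proof.
move=> ee [ft ftd].
have dft : differentiable f t by exact/derivable1_diffP.
have E : 'D_e f t = e * d.
  by rewrite deriveE // -[e in LHS]mulr1 [LHS]linearZ /= -deriveE // ftd.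
have G : (fun h : C => h^-1 *:
      (((fun u => f (e * u)) \o shift (e * t)) (h *: 1) - f (e * (e * t)))) =
    (fun h : C => h^-1 *: ((f \o shift t) (h *: e) - f t)).
  by apply/funext => h /=; rewrite mulrDr mulrA ee mul1r ![_ *: _]mulrC mul1r.
have Df : derivable f t e by exact: diff_derivable.
split; first by rewrite /derivable G.
by rewrite -E /derive G.
Qed.

(** This and the following rules restate differentiation for explicit [fun u => ...] with the field
    product, the shape on which [derive_compute] matches. *)
Lemma is_derive_addf f g t df dg : is_derive t 1 f df -> is_derive t 1 g dg ->
  is_derive t 1 (fun u => f u + g u) (df + dg).
Proof. exact: is_deriveD. Qed.

Lemma is_derive_oppf f t df : is_derive t 1 f df ->
  is_derive t 1 (fun u => - f u) (- df).
Proof. exact: is_deriveN. Qed.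

Lemma is_derive_mulf f g t df dg : is_derive t 1 f df -> is_derive t 1 g dg ->
  is_derive t 1 (fun u => f u * g u) (f t * dg + g t * df).
Proof. exact: is_deriveM. Qed.

Lemma is_derive_invf f t df : f t != 0 -> is_derive t 1 f df ->
  is_derive t 1 (fun u => (f u)^-1) (- (f t) ^- 2 * df).
Proof.
move=> ft0 [fd <-]; split; first exact: derivableV.
by rewrite deriveV.
Qed.

Lemma is_derive_cstf t (c : C) : is_derive t 1 (fun=> c) 0.
Proof. exact: is_derive_cst. Qed.

Lemma is_derive_idf t : is_derive t 1 (fun u : C => u) 1.
Proof. exact: is_derive_id. Qed.

End Derivatives.

(** * A pointwise criterion for the Backlund property *)

Section BacklundCriterion.
Variable C : numFieldType.
Local Notation pt := (@Defs.point C).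

Definition xdot (a : 'I_5 -> C) (x y z w t : C) : C :=
  (2 * x ^+ 2 * y - x ^+ 2 + (a 0 + a 1) * x - 2 * w) / t + 1.
Definition ydot (a : 'I_5 -> C) (x y z w t : C) : C :=
  (- 2 * x * y ^+ 2 + 2 * x * y - (a 0 + a 1) * y + a 1) / t.
Definition zdot (a : 'I_5 -> C) (x y z w t : C) : C :=
  (2 * z ^+ 2 * w - t * z ^+ 2 - (1 - a 3 - a 4) * z + 1 - 2 * y) / t.
Definition wdot (a : 'I_5 -> C) (x y z w t : C) : C :=
  (- 2 * z * w ^+ 2 + 2 * t * z * w + (1 - a 3 - a 4) * w + a 3 * t) / t.

(** All nine transformations send [t] to [e * t] with [e] equal to 1 or -1. By the chain rule it
    then suffices, at each point of the solution, that closed forms [fx], ..., [fw] give the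
    transformed values and have derivative [e] times the transformed vector field. *)
Lemma Backlund_of (s : automorphism C) (e : C) (b : ('I_5 -> C) -> 'I_5 -> C)
    (fx fy fz fw : C -> C -> C -> C -> C -> ('I_5 -> C) -> C) :
  e * e = 1 ->
  (forall a, param_rel a -> param_rel (b a) /\ forall x y z w t : C,
    has_value (s (rt C)) (pt x y z w t a) (e * t) /\
    forall i, has_value (s (ralpha C i)) (pt x y z w t a) (b a i)) ->
  (forall (a : 'I_5 -> C) (x y z w : C -> C) (t X Y Z W : C), param_rel a -> t != 0 ->
    is_derive t 1 x (xdot a (x t) (y t) (z t) (w t) t) ->
    is_derive t 1 y (ydot a (x t) (y t) (z t) (w t) t) ->
    is_derive t 1 z (zdot a (x t) (y t) (z t) (w t) t) ->
    is_derive t 1 w (wdot a (x t) (y t) (z t) (w t) t) ->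
    let v := pt (x t) (y t) (z t) (w t) t a in
    has_value (s (rx C)) v X -> has_value (s (ry C)) v Y ->
    has_value (s (rz C)) v Z -> has_value (s (rw C)) v W ->
    let f g := fun u => g (x u) (y u) (z u) (w u) u a in
    [/\ X = f fx t, Y = f fy t, Z = f fz t & W = f fw t] /\
    [/\ is_derive t 1 (f fx) (e * xdot (b a) X Y Z W (e * t)),
        is_derive t 1 (f fy) (e * ydot (b a) X Y Z W (e * t)),
        is_derive t 1 (f fz) (e * zdot (b a) X Y Z W (e * t))
      & is_derive t 1 (f fw) (e * wdot (b a) X Y Z W (e * t))]) ->
  Backlund s.
Proof.
move=> ee bP fP a D x y z w sol X Y Z W T A vals.
have [aP Dopen D0 dx dy dz dw] := sol.
have [baP b_val] := bP a aP.
have TE t : D t -> T t = e * t.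
  move=> Dt; have [[_ _ _ _ Tt] _] := vals t Dt.
  by apply: (evals_inj Tt); have [] := b_val (x t) (y t) (z t) (w t) t.
have eK t : e * (e * t) = t by rewrite mulrA ee mul1r.
(* As [e] is its own inverse, the new domain is the preimage of [D] under multiplication by [e],
   hence open. *)
have TD u : (T @` D)%classic u <-> D (e * u).
  split=> [[t Dt <-]|Du]; first by rewrite TE // eK.
  by exists (e * u) => //; rewrite TE // eK.
have TDE : (T @` D)%classic = ((fun u => e * u) @^-1` D)%classic.
  by apply/seteqP; split=> u /TD.
(* The old time is recovered from the new time [u] as [e * u]. *)
exists (b a), (fun u => X (e * u)), (fun u => Y (e * u)), (fun u => Z (e * u)),
  (fun u => W (e * u)).
pose f (g : C -> C -> C -> C -> C -> ('I_5 -> C) -> C) u :=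
  g (x u) (y u) (z u) (w u) u a.
have fD t : D t ->
    [/\ X t = f fx t, Y t = f fy t, Z t = f fz t & W t = f fw t] /\
    [/\ is_derive t 1 (f fx) (e * xdot (b a) (X t) (Y t) (Z t) (W t) (e * t)),
        is_derive t 1 (f fy) (e * ydot (b a) (X t) (Y t) (Z t) (W t) (e * t)),
        is_derive t 1 (f fz) (e * zdot (b a) (X t) (Y t) (Z t) (W t) (e * t))
      & is_derive t 1 (f fw) (e * wdot (b a) (X t) (Y t) (Z t) (W t) (e * t))].
  move=> Dt; have [[Xt Yt Zt Wt _] _] := vals t Dt.
  have t0 : t != 0 by apply/eqP => t0; apply: D0; rewrite -t0.
  exact: fP aP t0 (dx t Dt) (dy t Dt) (dz t Dt) (dw t Dt) Xt Yt Zt Wt.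
have TDopen : open (T @` D)%classic.
  rewrite TDE; apply: open_comp => // u _.
  by apply: continuousM; [exact: cst_continuous|exact: cvg_id].
(* [X], ..., [W] are controlled only on [D], where they agree with the closed forms; as the domain
   is open, agreement near [u] suffices to transfer the derivative. *)
have derive_T (F G : C -> C) d u : (T @` D)%classic u ->
    (forall t, D t -> F t = G t) -> is_derive (e * u) 1 G (e * d) ->
    is_derive u 1 (fun u => F (e * u)) d.
  move=> Du Ff /(is_derive_scale ee); rewrite mulrA ee mul1r eK; apply: near_eq_is_derive.
  have : nbhs u (T @` D)%classic by exact: open_nbhs_nbhs.
  by apply: filterS => v /TD /Ff ->.
split.
- move=> i t Dt; have [_ /(_ i) Ai] := vals t Dt.
  have [_ bi] := b_val (x t) (y t) (z t) (w t) t; exact: evals_inj Ai (bi i).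
- by move=> t Dt; rewrite TE // eK.
split=> //.
- by move=> /TD; rewrite mulr0.
- move=> u Du; apply: (derive_T _ (f fx)) => // [t /fD[[h _ _ _] _] //|].
  by have [_ [h _ _ _]] := fD _ (proj1 (TD u) Du); rewrite eK in h.
- move=> u Du; apply: (derive_T _ (f fy)) => // [t /fD[[_ h _ _] _] //|].
  by have [_ [_ h _ _]] := fD _ (proj1 (TD u) Du); rewrite eK in h.
- move=> u Du; apply: (derive_T _ (f fz)) => // [t /fD[[_ _ h _] _] //|].
  by have [_ [_ _ h _]] := fD _ (proj1 (TD u) Du); rewrite eK in h.
- move=> u Du; apply: (derive_T _ (f fw)) => // [t /fD[[_ _ _ h] _] //|].
  by have [_ [_ _ _ h]] := fD _ (proj1 (TD u) Du); rewrite eK in h.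
Qed.

End BacklundCriterion.

(** The side conditions of [field] may be arranged differently from the known nonvanishing facts, so
    they are matched up to [ring]. *)
Ltac nonzero_ring :=
  repeat (apply/andP; split);
  match goal with H : is_true (?d != 0) |- is_true (?e != 0) =>
    first [exact H | have <- : d = e by [ring]; exact H] end.

(** * The braid relation, uniformly in the outer node *)

Section Braid.
Variable K : fieldType.
Variables f g : {rmorphism K -> K}.

(* f is one of s_0, s_1, s_3, s_4 and g is s_2: f shifts p in {x, z} by
   b / (y - k), where y is the variable conjugate to p and k is one of 1, 0, t;
   (q, w) is the other conjugate pair. *)
Lemma braid_generators (p q y k w b c : K) :
  y - k != 0 -> p * q - 1 != 0 ->
  f p = p + b / (y - k) -> f q = q -> f y = y -> f k = k -> f w = w ->
  f b = - b -> f c = c + b ->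
  g p = p -> g q = q -> g y = y - c * q / (p * q - 1) -> g k = k ->
  g w = w - c * p / (p * q - 1) -> g b = b + c -> g c = - c ->
  let braid u := f (g (f u)) = g (f (g u)) in
  [/\ braid p, braid q, braid y & braid w].
Proof.
move=> d0 e0 fp fq fy fk fw fb fc gp gq gy gk gw gb gc braid.
(* The denominators of the composites are, up to a known nonzero factor, images of [y - k] under [g]
   (here) and of [p * q - 1] under [f] (in [n2]); these are nonzero because morphisms of fields are
   injective. *)
have n1 : (y - k) * (p * q - 1) - c * q != 0.
  have -> : (y - k) * (p * q - 1) - c * q = g (y - k) * (p * q - 1).
    by rewrite rmorphB gy gk /=; field.
  by rewrite mulf_neq0 // fmorph_eq0.
have n2 : (y - k) * (p * q - 1) + b * q != 0.
  have -> : (y - k) * (p * q - 1) + b * q = f (p * q - 1) * (y - k).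
    by rewrite rmorphB rmorphM rmorph1 fp fq /=; field.
  by rewrite mulf_neq0 // fmorph_eq0.
have n3 := mulf_neq0 d0 n1; have n4 := mulf_neq0 e0 n2.
pose rules := (rmorphD, rmorphN, rmorphM, fmorphV, rmorph1, fp, fq, fy, fk, fw, fb, fc,
  gp, gq, gy, gk, gw, gb, gc).
by split; rewrite /braid !rules //; field; nonzero_ring.
Qed.

End Braid.

(** * Tactics for verifying the criterion on explicit images *)

Ltac derive_compute :=
  lazymatch goal with
  | |- is_derive _ _ (fun _ => ?c) _ => eapply is_derive_cstf
  | |- is_derive _ _ (fun u => u) _ => eapply is_derive_idf
  | |- is_derive _ _ (fun u => @?f u + @?g u) _ =>
      eapply (@is_derive_addf _ f g); derive_compute
  | |- is_derive _ _ (fun u => @?f u * @?g u) _ =>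
      eapply (@is_derive_mulf _ f g); derive_compute
  | |- is_derive _ _ (fun u => - @?f u) _ =>
      eapply (@is_derive_oppf _ f); derive_compute
  | |- is_derive _ _ (fun u => (@?f u)^-1) _ =>
      eapply (@is_derive_invf _ f); [nonzero|derive_compute]
  | |- _ => eassumption
  end.

Ltac point_values :=
  let values aP x y z w t :=
    have [[? ? ? ? ?] /[dup] /(_ 0) ? /[dup] /(_ 1) ? /[dup] /(_ 2) ?
      /[dup] /(_ 3) ? /(_ 4) ?] := evals_point x y z w t aP in
  match goal with
  | aP : param_rel ?a |- context [Defs.point ?x ?y ?z ?w ?t ?a] =>
      values aP x y z w t
  | aP : param_rel ?a, _ : has_value _ (Defs.point ?x ?y ?z ?w ?t ?a) _ |- _ =>
      values aP x y z w t
  end.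

Ltac rewrite_images :=
  repeat match goal with E : GRing.RMorphism.sort _ _ = _ |- _ => rewrite ?E {E} end.

Ltac transformed_parameters :=
  let a := fresh "a" in let aP := fresh "aP" in intros a aP; split;
  [rewrite /param_rel /= (param_rel_a0 aP); ring|];
  intros; point_values; split;
  [rewrite_images; rewrite has_valueE; eapply evals_eq; [evals_compute idtac|ring]|];
  apply: ord5P; rewrite_images; evals_compute idtac.

(** Uniqueness of values turns each of [X], ..., [W] into its explicit expression; the closed forms
    are then differentiated mechanically, and the result is compared with the transformed vector
    field by [field]. *)
Ltac transformed_solution :=
  point_values;
  repeat match goal with V : has_value _ _ ?X |- _ =>
    let E := fresh in
    eassert (E : X = _) by (eapply (evals_inj V); evals_compute nonzero);
    clear V; subst X end;
  split; [by []|];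
  split; (eapply is_derive_eq; [derive_compute|
    match goal with aP : param_rel _ |- _ =>
      rewrite /xdot /ydot /zdot /wdot /= ?(param_rel_a0 aP) end;
    field; nonzero_ring]).

(** * The nine automorphisms *)

Section Symmetries.
Variable C : numFieldType.
Local Notation x := (rx C).
Local Notation y := (ry C).
Local Notation z := (rz C).
Local Notation w := (rw C).
Local Notation t := (rt C).
Local Notation a := (ralpha C).

Local Notation s0_images :=
  [:: x + a 0 / (y - 1); y; z; w; t;
      - a 0; a 1; a 2 + a 0; a 3; a 4].
Local Notation s1_images :=
  [:: x + a 1 / y; y; z; w; t;
      a 0; - a 1; a 2 + a 1; a 3; a 4].
Local Notation s2_images :=
  [:: x; y - a 2 * z / (x * z - 1); z; w - a 2 * x / (x * z - 1); t;
      a 0 + a 2; a 1 + a 2; - a 2; a 3 + a 2; a 4 + a 2].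
Local Notation s3_images :=
  [:: x; y; z + a 3 / w; w; t;
      a 0; a 1; a 2 + a 3; - a 3; a 4].
Local Notation s4_images :=
  [:: x; y; z + a 4 / (w - t); w; t;
      a 0; a 1; a 2 + a 4; a 3; - a 4].
Local Notation pi1_images :=
  [:: - x; 1 - y; - z; - w; - t; a 1; a 0; a 2; a 3; a 4].
Local Notation pi2_images :=
  [:: x; y; z; w - t; - t; a 0; a 1; a 2; a 4; a 3].
Local Notation pi3_images :=
  [:: t * z; w / t; x / t; t * y; t; a 4; a 3; a 2; a 1; a 0].
Local Notation pi4_images :=
  [:: - (t * z); (t - w) / t; - (x / t); t - t * y; t; a 3; a 4; a 2; a 0; a 1].

(** The list follows [generators], where position 5 holds [a 0], which is not an indeterminate;
    later positions are therefore shifted by one. *)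
Definition images (L : seq (ratfun C)) (i : 'I_9) : ratfun C :=
  L`_(if (i < 5)%N then i : nat else i.+1).

(** The image of [a 0] follows from the linear relation by [A0E], so the involution is checked on
    the nine indeterminates only. *)
Lemma involution_of_images (X Y Z W T A0 A1 A2 A3 A4 : ratfun C) :
  let L := [:: X; Y; Z; W; T; A0; A1; A2; A3; A4] in
  A0 = 1 - A1 - 2 * A2 - A3 - A4 ->
  let ev := evals (subst (images L)) in
  (ev x X -> ev y Y -> ev z Z -> ev w W -> ev t T -> ev (a 0) A0 -> ev (a 1) A1 ->
   ev (a 2) A2 -> ev (a 3) A3 -> ev (a 4) A4 ->
   [/\ ev X x, ev Y y, ev Z z, ev W w & ev T t] /\
   [/\ ev A1 (a 1), ev A2 (a 2), ev A3 (a 3) & ev A4 (a 4)]) ->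
  exists s : automorphism C, involutive s /\ map s (generators C) = L.
Proof.
move=> L A0E ev H.
have evX i : ev (indet C i) (images L i) by exact: evals_indet.
have e1 := evX 5; have e2 := evX 6; have e3 := evX 7; have e4 := evX 8.
have e0 : ev (a 0) A0.
  by rewrite A0E /ralpha /= /ev; evals_compute idtac.
have [[HX HY HZ HW HT] [H1 H2 H3 H4]] :=
  H (evX 0) (evX 1) (evX 2) (evX 3) (evX 4) e0 e1 e2 e3 e4.
have gK i : ev (images L i) (indet C i).
  by case: i => [[|[|[|[|[|[|[|[|[|i]]]]]]]]] Hi].
have [s [sK sX]] := involutive_automorphism gK.
exists s; split=> //.
have s1 : s (a 1) = A1 by exact: sX.
have s2 : s (a 2) = A2 by exact: sX.
have s3 : s (a 3) = A3 by exact: sX.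
have s4 : s (a 4) = A4 by exact: sX.
have s0 : s (a 0) = A0.
  by rewrite (param_rel_a0 (ralpha_rel C)) !rmorphB rmorphM rmorph_nat rmorph1 s1 s2 s3 s4 -A0E.
by rewrite /generators /= s0 s1 s2 s3 s4 [s x]sX [s y]sX [s z]sX [s w]sX [s t]sX.
Qed.

Lemma ralpha0E : a 0 = 1 - a 1 - 2 * a 2 - a 3 - a 4.
Proof. exact: param_rel_a0 (ralpha_rel C). Qed.

Lemma denominators_neq0 :
  [/\ y != 0, y - 1 != 0 & x * z - 1 != 0] /\ [/\ w != 0, w - t != 0 & t != 0].
Proof.
(* These are the parameters (1, 0, 0, 0, 0), the zeros being the default of the list lookup. At the
   point chosen below the six denominators, in the order of the statement, are 2, 1, -1, 1, -1,
   2. *)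
pose b i : C := [:: 1]`_i.
have bP : param_rel b by rewrite /b /param_rel /=; ring.
have [[ex ey ez ew et] _] := evals_point 0 2 0 1 2 bP.
have ev_neq0 := @evals_neq0 C C (mpoly.meval (Defs.point 0 2 0 1 2 b)).
have n2 : (2 : C) != 0 by rewrite pnatr_eq0.
split; split; [apply: ev_neq0 ey n2| | |apply: ev_neq0 ew _| |apply: ev_neq0 et n2].
- by apply: (@ev_neq0 _ (2 - 1)); [evals_compute idtac|rewrite addrK oner_neq0].
- apply: (@ev_neq0 _ (0 * 0 - 1)); first evals_compute idtac.
  by rewrite mul0r sub0r oppr_eq0 oner_neq0.
- exact: oner_neq0.
- apply: (@ev_neq0 _ (1 - 2)); first evals_compute idtac.
  by rewrite opprD addNKr oppr_eq0 oner_neq0.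
Qed.

(* Conversion tests between closed terms of the fraction field are expensive,
   so [ring] and [field] are only run on variables of an arbitrary field. *)
Ltac abstract_field :=
  move: denominators_neq0;
  move: (rx C) (ry C) (rz C) (rw C) (rt C) (a 0) (a 1) (a 2) (a 3) (a 4);
  move: (ratfun C) => K x y z w t a0 a1 a2 a3 a4 [[y0 y1 xz0] [w0 wt0 t0]].

Ltac prove_involution :=
  have [[y0 y1 xz0] [w0 wt0 t0]] := denominators_neq0;
  apply: involution_of_images; [generalize ralpha0E; generalize (a 0) => ? ->; ring|];
  move=> ex ey ez ew et e0 e1 e2 e3 e4; split; split;
  (eapply evals_eq; [evals_compute nonzero|
    clear; abstract_field; first [ring | field; nonzero]]).

Lemma s0_exists : exists s : automorphism C, involutive s /\
  map s (generators C) = s0_images.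
Proof. prove_involution. Qed.

Lemma s1_exists : exists s : automorphism C, involutive s /\
  map s (generators C) = s1_images.
Proof. prove_involution. Qed.

Lemma s2_exists : exists s : automorphism C, involutive s /\
  map s (generators C) = s2_images.
Proof. prove_involution. Qed.

Lemma s3_exists : exists s : automorphism C, involutive s /\
  map s (generators C) = s3_images.
Proof. prove_involution. Qed.

Lemma s4_exists : exists s : automorphism C, involutive s /\
  map s (generators C) = s4_images.
Proof. prove_involution. Qed.

Lemma pi1_exists : exists s : automorphism C, involutive s /\
  map s (generators C) = pi1_images.
Proof. prove_involution. Qed.

Lemma pi2_exists : exists s : automorphism C, involutive s /\
  map s (generators C) = pi2_images.
Proof. prove_involution. Qed.

Lemma pi3_exists : exists s : automorphism C, involutive s /\
  map s (generators C) = pi3_images.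
Proof. prove_involution. Qed.

Lemma pi4_exists : exists s : automorphism C, involutive s /\
  map s (generators C) = pi4_images.
Proof. prove_involution. Qed.

(** * Commutation and braid relations *)

Lemma automorphism_gen_eq (f h : {rmorphism ratfun C -> ratfun C}) :
  (forall c, f (ratconst c) = h (ratconst c)) ->
  [/\ f x = h x, f y = h y, f z = h z, f w = h w & f t = h t] /\
  [/\ f (a 1) = h (a 1), f (a 2) = h (a 2), f (a 3) = h (a 3) & f (a 4) = h (a 4)] ->
  f =1 h.
Proof.
move=> fhC [[Ex Ey Ez Ew Et] [E1 E2 E3 E4]]; apply: automorphism_eq fhC _.
by case=> [[|[|[|[|[|[|[|[|[|i]]]]]]]]] Hi].
Qed.

(** The composites are packaged as ring morphisms, so that equality on generators and constants
    suffices; [braid_eq] does the same for triple composites. *)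
Lemma commute_eq (f h : automorphism C) :
  [/\ f (h x) = h (f x), f (h y) = h (f y), f (h z) = h (f z), f (h w) = h (f w)
    & f (h t) = h (f t)] /\
  [/\ f (h (a 1)) = h (f (a 1)), f (h (a 2)) = h (f (a 2)), f (h (a 3)) = h (f (a 3))
    & f (h (a 4)) = h (f (a 4))] ->
  f \o h =1 h \o f.
Proof.
pose fh : {rmorphism _ -> _} := aut_morph f \o aut_morph h.
pose hf : {rmorphism _ -> _} := aut_morph h \o aut_morph f.
by apply: (@automorphism_gen_eq fh hf) => c /=; rewrite !aut_const.
Qed.

Lemma braid_eq (f h : automorphism C) :
  let braid u := f (h (f u)) = h (f (h u)) in
  [/\ braid x, braid y, braid z, braid w & braid t] /\
  [/\ braid (a 1), braid (a 2), braid (a 3) & braid (a 4)] ->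
  f \o (h \o f) =1 h \o (f \o h).
Proof.
pose fhf : {rmorphism _ -> _} := aut_morph f \o (aut_morph h \o aut_morph f).
pose hfh : {rmorphism _ -> _} := aut_morph h \o (aut_morph f \o aut_morph h).
by move=> b; apply: (@automorphism_gen_eq fhf hfh) => // c /=; rewrite !aut_const.
Qed.

Lemma generators_mapE (f : automorphism C) (X Y Z W T A0 A1 A2 A3 A4 : ratfun C) :
  map f (generators C) = [:: X; Y; Z; W; T; A0; A1; A2; A3; A4] ->
  [/\ f x = X, f y = Y, f z = Z, f w = W & f t = T] /\
  [/\ f (a 0) = A0, f (a 1) = A1, f (a 2) = A2, f (a 3) = A3 & f (a 4) = A4].
Proof. by case. Qed.

Ltac abstract_relation :=
  move=> /generators_mapE + /generators_mapE;
  match goal with f : automorphism C, g : automorphism C |- _ =>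
    move: (aut_morph f) (aut_morph g); clear f g end;
  move: denominators_neq0;
  move: (rx C) (ry C) (rz C) (rw C) (rt C) (a 0) (a 1) (a 2) (a 3) (a 4);
  move: (ratfun C) => K X Y Z W T b0 b1 b2 b3 b4
    [[y0 y1 xz0] [w0 wt0 t0]] f g
    [[fX fY fZ fW fT] [f0 f1 f2 f3 f4]] [[gX gY gZ gW gT] [g0 g1 g2 g3 g4]].

Ltac push_morphisms := repeat (
  rewrite ?(rmorphD, rmorphN, rmorphM, fmorphV, rmorph1) //;
  match goal with E : GRing.RMorphism.sort ?f ?u = _ |-
    context [GRing.RMorphism.sort ?f ?u] => rewrite E end).

Lemma commute_s0_s1 (f g : automorphism C) :
  map f (generators C) = s0_images -> map g (generators C) = s1_images ->
  f \o g =1 g \o f.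
Proof.
move=> Ef Eg; apply: commute_eq; move: Ef Eg; abstract_relation.
by split; split; push_morphisms; first [ring | field; nonzero_ring].
Qed.

Lemma commute_s0_s3 (f g : automorphism C) :
  map f (generators C) = s0_images -> map g (generators C) = s3_images ->
  f \o g =1 g \o f.
Proof.
move=> Ef Eg; apply: commute_eq; move: Ef Eg; abstract_relation.
by split; split; push_morphisms; first [ring | field; nonzero_ring].
Qed.

Lemma commute_s0_s4 (f g : automorphism C) :
  map f (generators C) = s0_images -> map g (generators C) = s4_images ->
  f \o g =1 g \o f.
Proof.
move=> Ef Eg; apply: commute_eq; move: Ef Eg; abstract_relation.
by split; split; push_morphisms; first [ring | field; nonzero_ring].
Qed.

Lemma commute_s1_s3 (f g : automorphism C) :
  map f (generators C) = s1_images -> map g (generators C) = s3_images ->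
  f \o g =1 g \o f.
Proof.
move=> Ef Eg; apply: commute_eq; move: Ef Eg; abstract_relation.
by split; split; push_morphisms; first [ring | field; nonzero_ring].
Qed.

Lemma commute_s1_s4 (f g : automorphism C) :
  map f (generators C) = s1_images -> map g (generators C) = s4_images ->
  f \o g =1 g \o f.
Proof.
move=> Ef Eg; apply: commute_eq; move: Ef Eg; abstract_relation.
by split; split; push_morphisms; first [ring | field; nonzero_ring].
Qed.

Lemma commute_s3_s4 (f g : automorphism C) :
  map f (generators C) = s3_images -> map g (generators C) = s4_images ->
  f \o g =1 g \o f.
Proof.
move=> Ef Eg; apply: commute_eq; move: Ef Eg; abstract_relation.
by split; split; push_morphisms; first [ring | field; nonzero_ring].
Qed.

Lemma braid_s0_s2 (f g : automorphism C) :
  map f (generators C) = s0_images -> map g (generators C) = s2_images ->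
  f \o (g \o f) =1 g \o (f \o g).
Proof.
move=> Ef Eg; apply: braid_eq; move: Ef Eg; abstract_relation.
(* The shifted variable is [x], with pole at [y = 1]; only [t] and the parameters remain, and there
   the relation is polynomial. *)
have [||||||||||||||||bX bZ bY bW] := @braid_generators K f g X Z Y 1 W b0 b2;
  rewrite ?subr0 ?rmorph1 ?rmorph0 // ?(mulrC Z X) //.
by split; split=> //; push_morphisms; ring.
Qed.

Lemma braid_s1_s2 (f g : automorphism C) :
  map f (generators C) = s1_images -> map g (generators C) = s2_images ->
  f \o (g \o f) =1 g \o (f \o g).
Proof.
move=> Ef Eg; apply: braid_eq; move: Ef Eg; abstract_relation.
have [||||||||||||||||bX bZ bY bW] := @braid_generators K f g X Z Y 0 W b1 b2;
  rewrite ?subr0 ?rmorph1 ?rmorph0 // ?(mulrC Z X) //.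
by split; split=> //; push_morphisms; ring.
Qed.

Lemma braid_s3_s2 (f g : automorphism C) :
  map f (generators C) = s3_images -> map g (generators C) = s2_images ->
  f \o (g \o f) =1 g \o (f \o g).
Proof.
move=> Ef Eg; apply: braid_eq; move: Ef Eg; abstract_relation.
(* The two conjugate pairs exchange roles: the shifted variable is [z], with pole at [w = 0].
   Commuting the product reconciles [z * x - 1] with the denominator of [s_2]. *)
have [||||||||||||||||bZ bX bW bY] := @braid_generators K f g Z X W 0 Y b3 b2;
  rewrite ?subr0 ?rmorph1 ?rmorph0 // ?(mulrC Z X) //.
by split; split=> //; push_morphisms; ring.
Qed.

Lemma braid_s4_s2 (f g : automorphism C) :
  map f (generators C) = s4_images -> map g (generators C) = s2_images ->
  f \o (g \o f) =1 g \o (f \o g).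
Proof.
move=> Ef Eg; apply: braid_eq; move: Ef Eg; abstract_relation.
(* As for [s_3], with the pole now at [w = t]. *)
have [||||||||||||||||bZ bX bW bY] := @braid_generators K f g Z X W T Y b4 b2;
  rewrite ?subr0 ?rmorph1 ?rmorph0 // ?(mulrC Z X) //.
by split; split=> //; push_morphisms; ring.
Qed.

(** * The Backlund property of each transformation *)

Lemma Backlund_s0 (s : automorphism C) :
  map s (generators C) = s0_images -> Backlund s.
Proof.
move=> /generators_mapE [[Ex Ey Ez Ew Et] [E0 E1 E2 E3 E4]].
apply: (@Backlund_of C s 1 (fun a i => [:: - a 0; a 1; a 2 + a 0; a 3; a 4]`_i)
  (fun x y z w t a => x + a 0 / (y - 1)) (fun x y z w t a => y)
  (fun x y z w t a => z) (fun x y z w t a => w)).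
- by rewrite mulr1.
- transformed_parameters.
move=> a x y z w t X Y Z W aP t0 dx dy dz dw /=; rewrite_images => VX VY VZ VW.
have d0 : y t - 1 != 0.
  (* The shift is put in the form [ralpha C k * U / D] with [U = 1]. *)
  rewrite -[ralpha C 0]mulr1 in VX.
  apply: (regular_denominator_neq0 (m := x t) (u := 1) aP VX); rewrite ?oner_neq0 //.
    by move=> b bP ev; rewrite /ev; point_values; split; evals_compute idtac.
  by have [[_ y1 _] _] := denominators_neq0; exact: y1.
transformed_solution.
Qed.

Lemma Backlund_s1 (s : automorphism C) :
  map s (generators C) = s1_images -> Backlund s.
Proof.
move=> /generators_mapE [[Ex Ey Ez Ew Et] [E0 E1 E2 E3 E4]].
apply: (@Backlund_of C s 1 (fun a i => [:: a 0; - a 1; a 2 + a 1; a 3; a 4]`_i)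
  (fun x y z w t a => x + a 1 / y) (fun x y z w t a => y)
  (fun x y z w t a => z) (fun x y z w t a => w)).
- by rewrite mulr1.
- transformed_parameters.
move=> a x y z w t X Y Z W aP t0 dx dy dz dw /=; rewrite_images => VX VY VZ VW.
have d0 : y t != 0.
  rewrite -[ralpha C 1]mulr1 in VX.
  apply: (regular_denominator_neq0 (m := x t) (u := 1) aP VX); rewrite ?oner_neq0 //.
    by move=> b bP ev; rewrite /ev; point_values; split; evals_compute idtac.
  by have [[y0 _ _] _] := denominators_neq0; exact: y0.
transformed_solution.
Qed.

Lemma Backlund_s2 (s : automorphism C) :
  map s (generators C) = s2_images -> Backlund s.
Proof.
move=> /generators_mapE [[Ex Ey Ez Ew Et] [E0 E1 E2 E3 E4]].
apply: (@Backlund_of C s 1 (fun a i => [:: a 0 + a 2; a 1 + a 2; - a 2; a 3 + a 2; a 4 + a 2]`_i)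
  (fun x y z w t a => x) (fun x y z w t a => y - a 2 * z / (x * z - 1))
  (fun x y z w t a => z) (fun x y z w t a => w - a 2 * x / (x * z - 1))).
- by rewrite mulr1.
- transformed_parameters.
move=> a x y z w t X Y Z W aP t0 dx dy dz dw /=; rewrite_images => VX VY VZ VW.
have d0 : x t * z t - 1 != 0.
  (* The numerator of the shift of [y] contains [z], so the regularity argument applies only where
     [z] is nonzero; where [z] vanishes the denominator is -1. *)
  have [->|z0] := eqVneq (z t) 0; first by rewrite mulr0 sub0r oppr_eq0 oner_neq0.
  rewrite -mulNr -mulrN in VY.
  apply: (regular_denominator_neq0 (m := y t) (u := - z t) aP VY); rewrite ?oppr_eq0 //.
    by move=> b bP ev; rewrite /ev; point_values; split; evals_compute idtac.
  by have [[_ _ xz0] _] := denominators_neq0; exact: xz0.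
transformed_solution.
Qed.

Lemma Backlund_s3 (s : automorphism C) :
  map s (generators C) = s3_images -> Backlund s.
Proof.
move=> /generators_mapE [[Ex Ey Ez Ew Et] [E0 E1 E2 E3 E4]].
apply: (@Backlund_of C s 1 (fun a i => [:: a 0; a 1; a 2 + a 3; - a 3; a 4]`_i)
  (fun x y z w t a => x) (fun x y z w t a => y)
  (fun x y z w t a => z + a 3 / w) (fun x y z w t a => w)).
- by rewrite mulr1.
- transformed_parameters.
move=> a x y z w t X Y Z W aP t0 dx dy dz dw /=; rewrite_images => VX VY VZ VW.
have d0 : w t != 0.
  rewrite -[ralpha C 3]mulr1 in VZ.
  apply: (regular_denominator_neq0 (m := z t) (u := 1) aP VZ); rewrite ?oner_neq0 //.
    by move=> b bP ev; rewrite /ev; point_values; split; evals_compute idtac.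
  by have [_ [w0 _ _]] := denominators_neq0; exact: w0.
transformed_solution.
Qed.

Lemma Backlund_s4 (s : automorphism C) :
  map s (generators C) = s4_images -> Backlund s.
Proof.
move=> /generators_mapE [[Ex Ey Ez Ew Et] [E0 E1 E2 E3 E4]].
apply: (@Backlund_of C s 1 (fun a i => [:: a 0; a 1; a 2 + a 4; a 3; - a 4]`_i)
  (fun x y z w t a => x) (fun x y z w t a => y)
  (fun x y z w t a => z + a 4 / (w - t)) (fun x y z w t a => w)).
- by rewrite mulr1.
- transformed_parameters.
move=> a x y z w t X Y Z W aP t0 dx dy dz dw /=; rewrite_images => VX VY VZ VW.
have d0 : w t - t != 0.
  rewrite -[ralpha C 4]mulr1 in VZ.
  apply: (regular_denominator_neq0 (m := z t) (u := 1) aP VZ); rewrite ?oner_neq0 //.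
    by move=> b bP ev; rewrite /ev; point_values; split; evals_compute idtac.
  by have [_ [_ wt0 _]] := denominators_neq0; exact: wt0.
transformed_solution.
Qed.

(** Time is reversed here and in [Backlund_pi2], hence [e = -1]; the images are polynomial. *)
Lemma Backlund_pi1 (s : automorphism C) :
  map s (generators C) = pi1_images -> Backlund s.
Proof.
move=> /generators_mapE [[Ex Ey Ez Ew Et] [E0 E1 E2 E3 E4]].
apply: (@Backlund_of C s (-1) (fun a i => [:: a 1; a 0; a 2; a 3; a 4]`_i)
  (fun x y z w t a => - x) (fun x y z w t a => 1 - y)
  (fun x y z w t a => - z) (fun x y z w t a => - w)).
- by rewrite mulrNN mulr1.
- transformed_parameters.
move=> a x y z w t X Y Z W aP t0 dx dy dz dw /=; rewrite_images => VX VY VZ VW.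
transformed_solution.
Qed.

Lemma Backlund_pi2 (s : automorphism C) :
  map s (generators C) = pi2_images -> Backlund s.
Proof.
move=> /generators_mapE [[Ex Ey Ez Ew Et] [E0 E1 E2 E3 E4]].
apply: (@Backlund_of C s (-1) (fun a i => [:: a 0; a 1; a 2; a 4; a 3]`_i)
  (fun x y z w t a => x) (fun x y z w t a => y)
  (fun x y z w t a => z) (fun x y z w t a => w - t)).
- by rewrite mulrNN mulr1.
- transformed_parameters.
move=> a x y z w t X Y Z W aP t0 dx dy dz dw /=; rewrite_images => VX VY VZ VW.
transformed_solution.
Qed.

(** The only denominator, here and in [Backlund_pi4], is [t], nonzero because the domain of a
    solution avoids 0. *)
Lemma Backlund_pi3 (s : automorphism C) :
  map s (generators C) = pi3_images -> Backlund s.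
Proof.
move=> /generators_mapE [[Ex Ey Ez Ew Et] [E0 E1 E2 E3 E4]].
apply: (@Backlund_of C s 1 (fun a i => [:: a 4; a 3; a 2; a 1; a 0]`_i)
  (fun x y z w t a => t * z) (fun x y z w t a => w / t)
  (fun x y z w t a => x / t) (fun x y z w t a => t * y)).
- by rewrite mulr1.
- transformed_parameters.
move=> a x y z w t X Y Z W aP t0 dx dy dz dw /=; rewrite_images => VX VY VZ VW.
transformed_solution.
Qed.

Lemma Backlund_pi4 (s : automorphism C) :
  map s (generators C) = pi4_images -> Backlund s.
Proof.
move=> /generators_mapE [[Ex Ey Ez Ew Et] [E0 E1 E2 E3 E4]].
apply: (@Backlund_of C s 1 (fun a i => [:: a 3; a 4; a 2; a 0; a 1]`_i)
  (fun x y z w t a => - (t * z)) (fun x y z w t a => (t - w) / t)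
  (fun x y z w t a => - (x / t)) (fun x y z w t a => t - t * y)).
- by rewrite mulr1.
- transformed_parameters.
move=> a x y z w t X Y Z W aP t0 dx dy dz dw /=; rewrite_images => VX VY VZ VW.
transformed_solution.
Qed.

End Symmetries.

(** * Coxeter relations and conclusion *)

Lemma iter_commute (T : Type) (f g : T -> T) :
  involutive f -> involutive g -> f \o g =1 g \o f ->
  iter 2 (f \o g) =1 id /\ iter 2 (g \o f) =1 id.
Proof.
move=> fK gK fg; split=> u /=.
  by rewrite [f (g _)]fg /= fK gK.
by rewrite -[g (f _)]fg /= gK fK.
Qed.

(** Replacing the leading [f g f] of [f g f g f g] by [g f g] makes the word cancel by involutivity.
    Both orders are recorded, as in [iter_commute], because the Coxeter relations range over ordered
    pairs. *)
Lemma iter_braid (T : Type) (f g : T -> T) :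
  involutive f -> involutive g -> f \o (g \o f) =1 g \o (f \o g) ->
  iter 3 (f \o g) =1 id /\ iter 3 (g \o f) =1 id.
Proof.
move=> fK gK fg; split=> u /=.
  by rewrite [f (g (f _))]fg /= gK fK gK.
by rewrite -[g (f (g _))]fg /= fK gK fK.
Qed.

Theorem theorem2p1 (R : realType) :
  let C := complex_field R in
  let x := rx C in let y := ry C in let z := rz C in let w := rw C in
  let t := rt C in let a := ralpha C in
  exists (s : 'I_5 -> automorphism C) (pi1 pi2 pi3 pi4 : automorphism C),
  [/\ [/\ map (s 0) (generators C) =
            [:: x + a 0 / (y - 1); y; z; w; t;
                - a 0; a 1; a 2 + a 0; a 3; a 4],
          map (s 1) (generators C) =
            [:: x + a 1 / y; y; z; w; t;
                a 0; - a 1; a 2 + a 1; a 3; a 4],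
          map (s 2) (generators C) =
            [:: x; y - a 2 * z / (x * z - 1); z; w - a 2 * x / (x * z - 1); t;
                a 0 + a 2; a 1 + a 2; - a 2; a 3 + a 2; a 4 + a 2],
          map (s 3) (generators C) =
            [:: x; y; z + a 3 / w; w; t;
                a 0; a 1; a 2 + a 3; - a 3; a 4]
        & map (s 4) (generators C) =
            [:: x; y; z + a 4 / (w - t); w; t;
                a 0; a 1; a 2 + a 4; a 3; - a 4]],
      [/\ map pi1 (generators C) =
            [:: - x; 1 - y; - z; - w; - t; a 1; a 0; a 2; a 3; a 4],
          map pi2 (generators C) =
            [:: x; y; z; w - t; - t; a 0; a 1; a 2; a 4; a 3],
          map pi3 (generators C) =
            [:: t * z; w / t; x / t; t * y; t; a 4; a 3; a 2; a 1; a 0]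
        & map pi4 (generators C) =
            [:: - (t * z); (t - w) / t; - (x / t); t - t * y; t;
                a 3; a 4; a 2; a 0; a 1]],
      [/\ forall i : 'I_5, Backlund (s i),
          Backlund pi1, Backlund pi2, Backlund pi3 & Backlund pi4]
    & forall i j : 'I_5, iter (D4_exponent i j) (s i \o s j) =1 id].
Proof.
move=> C x y z w t a.
have [s0 [s0K Es0]] := s0_exists C.
have [s1 [s1K Es1]] := s1_exists C.
have [s2 [s2K Es2]] := s2_exists C.
have [s3 [s3K Es3]] := s3_exists C.
have [s4 [s4K Es4]] := s4_exists C.
have [pi1 [_ Epi1]] := pi1_exists C.
have [pi2 [_ Epi2]] := pi2_exists C.
have [pi3 [_ Epi3]] := pi3_exists C.
have [pi4 [_ Epi4]] := pi4_exists C.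
have [r01 r10] := iter_commute s0K s1K (commute_s0_s1 Es0 Es1).
have [r03 r30] := iter_commute s0K s3K (commute_s0_s3 Es0 Es3).
have [r04 r40] := iter_commute s0K s4K (commute_s0_s4 Es0 Es4).
have [r13 r31] := iter_commute s1K s3K (commute_s1_s3 Es1 Es3).
have [r14 r41] := iter_commute s1K s4K (commute_s1_s4 Es1 Es4).
have [r34 r43] := iter_commute s3K s4K (commute_s3_s4 Es3 Es4).
have [r02 r20] := iter_braid s0K s2K (braid_s0_s2 Es0 Es2).
have [r12 r21] := iter_braid s1K s2K (braid_s1_s2 Es1 Es2).
have [r32 r23] := iter_braid s3K s2K (braid_s3_s2 Es3 Es2).
have [r42 r24] := iter_braid s4K s2K (braid_s4_s2 Es4 Es2).
exists (fun i : 'I_5 => nth s0 [:: s0; s1; s2; s3; s4] i), pi1, pi2, pi3, pi4.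
split; first by split; [exact: Es0|exact: Es1|exact: Es2|exact: Es3|exact: Es4].
- by split; [exact: Epi1|exact: Epi2|exact: Epi3|exact: Epi4].
- split; [|exact: Backlund_pi1 Epi1|exact: Backlund_pi2 Epi2
    |exact: Backlund_pi3 Epi3|exact: Backlund_pi4 Epi4].
  apply: ord5P; [exact: Backlund_s0 Es0|exact: Backlund_s1 Es1
    |exact: Backlund_s2 Es2|exact: Backlund_s3 Es3|exact: Backlund_s4 Es4].
(* The 25 ordered pairs, row by row; on the diagonal the exponent is 1 and the relation is
   involutivity. *)
- apply: ord5P; apply: ord5P;
    [exact: s0K|exact: r01|exact: r02|exact: r03|exact: r04
    |exact: r10|exact: s1K|exact: r12|exact: r13|exact: r14
    |exact: r20|exact: r21|exact: s2K|exact: r23|exact: r24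
    |exact: r30|exact: r31|exact: r32|exact: s3K|exact: r34
    |exact: r40|exact: r41|exact: r42|exact: r43|exact: s4K].
Qed.
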